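(* Let $V$ be an $n$-element set, $n\geq 3$. Then: (i) The Boolean sublattices of $\mathrm{Part}(V)$ of largest size are $(n-1)$-dimensional. (ii) The Boolean sublattices of $\mathrm{Part}(V)$ of dimension $n-1$ correspond bijectively to the trees with node set $V$, where the lattice corresponding to a tree $T$ consists of all partitions of $V$ each of whose blocks is a connected node set of $T$ (i.e. the vertex set of a subtree of $T$).
   Context: $\mathrm{Part}(V)$ is the lattice of all partitions of $V$ ordered by refinement ($\pi_1\le\pi_2$ iff every block of $\pi_2$ is a union of blocks of $\pi_1$). A Boolean sublattice is a sublattice (closed under meet and join of $\mathrm{Part}(V)$) that is itself a Boolean lattice. The dimension of a finite Boolean lattice is its number of atoms (equal to its height). *)

(* Defs.v *)
From HB Require Import structures.
From mathcomp Require Import all_boot all_order.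

Set Implicit Arguments.
Unset Strict Implicit.
Unset Printing Implicit Defensive.

Import Order.TTheory.

Section Part.
Variable V : finType.

Record part := Part {
  blocks :> {set {set V}};
  partP : partition blocks [set: V]
}.

HB.instance Definition _ := [isSub for blocks].
HB.instance Definition _ := [Finite of part by <:].

Implicit Types (P Q R : part) (x y z : V) (r : rel V).

Definition refines P Q : bool :=
  [forall B in blocks Q,
    exists S : {set {set V}}, (S \subset blocks P) && (B == cover S)].

Local Notation blk P := (pblock (blocks P)).

Lemma cover_part P : cover (blocks P) = [set: V].
Proof. exact/cover_partition/partP. Qed.

Lemma trivIset_part P : trivIset (blocks P).
Proof. exact/partition_trivIset/partP. Qed.

Lemma blk_in P x : blk P x \in blocks P.
Proof. by rewrite pblock_mem // cover_part inE. Qed.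

Lemma blk_refl P x : x \in blk P x.
Proof. by rewrite mem_pblock cover_part inE. Qed.

Lemma blk_def P (B : {set V}) x : B \in blocks P -> x \in B -> blk P x = B.
Proof. exact/def_pblock/trivIset_part. Qed.

Lemma blk_eq P x y : y \in blk P x -> blk P y = blk P x.
Proof. by move=> yx; apply: blk_def => //; apply: blk_in. Qed.

Lemma blk_sym P x y : (x \in blk P y) = (y \in blk P x).
Proof. by apply/idP/idP=> /blk_eq->; apply: blk_refl. Qed.

Lemma refinesP P Q :
  reflect (forall x, blk P x \subset blk Q x) (refines P Q).
Proof.
apply: (iffP forall_inP) => [PQ x|PQ B QB].
  have /existsP[S /andP[/subsetP SP /eqP defB]] := PQ _ (blk_in Q x).
  have : x \in blk Q x by apply: blk_refl.
  rewrite defB => /bigcupP[C CS xC].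
  by rewrite (blk_def (SP _ CS) xC) (bigcup_max C).
apply/existsP; exists [set blk P x | x in B]; apply/andP; split.
  by apply/subsetP=> _ /imsetP[x _ ->]; apply: blk_in.
rewrite eqEsubset; apply/andP; split.
  apply/subsetP=> x xB; apply/bigcupP; exists (blk P x); last exact: blk_refl.
  exact: imset_f.
apply/bigcupsP=> _ /imsetP[x xB ->].
by rewrite -(blk_def QB xB).
Qed.

Lemma refines_refl : reflexive refines.
Proof. by move=> P; apply/refinesP. Qed.

Lemma refines_trans : transitive refines.
Proof.
move=> Q P R /refinesP PQ /refinesP QR; apply/refinesP=> x.
exact: subset_trans (PQ x) (QR x).
Qed.

Lemma refines_anti : antisymmetric refines.
Proof.
move=> P Q /andP[/refinesP PQ /refinesP QP].
have eqb x : blk P x = blk Q x by apply/eqP; rewrite eqEsubset PQ QP.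
apply/val_inj/setP=> B /=; apply/idP/idP=> BP.
  have /set0Pn[x xB] := partition_neq0 (partP P) BP.
  by rewrite -(blk_def BP xB) eqb blk_in.
have /set0Pn[x xB] := partition_neq0 (partP Q) BP.
by rewrite -(blk_def BP xB) -eqb blk_in.
Qed.

Definition part_of_rel r (eqr : equivalence_rel r) : part :=
  Part (@equivalence_partitionP V r setT (in3W eqr)).

Lemma part_of_relE r (eqr : equivalence_rel r) x y :
  (y \in blk (part_of_rel eqr) x) = r x y.
Proof. by rewrite pblock_equivalence_partition ?inE //; apply: in3W. Qed.

Definition meet_rel P Q : rel V := [rel x y | (y \in blk P x) && (y \in blk Q x)].

Lemma meet_rel_eqv P Q : equivalence_rel (meet_rel P Q).
Proof.
move=> x y z; rewrite /meet_rel /=; split=> [|/andP[xyP xyQ]]; first by rewrite !blk_refl.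
by rewrite (blk_eq xyP) (blk_eq xyQ).
Qed.

Definition join_rel P Q : rel V :=
  connect [rel x y | (y \in blk P x) || (y \in blk Q x)].

Lemma join_rel_eqv P Q : equivalence_rel (join_rel P Q).
Proof.
move=> x y z; split=> [|xy]; first exact: connect0.
apply: (same_connect _ xy); apply: sym_connect_sym => u v /=.
by rewrite !(blk_sym _ u).
Qed.

Definition part_meet P Q : part := part_of_rel (meet_rel_eqv P Q).
Definition part_join P Q : part := part_of_rel (join_rel_eqv P Q).

Lemma refines_meet R P Q :
  refines R (part_meet P Q) = refines R P && refines R Q.
Proof.
apply/refinesP/andP=> [RPQ|[/refinesP RP /refinesP RQ] x].
  split; apply/refinesP=> x; apply/subsetP=> y /(subsetP (RPQ x));
    by rewrite part_of_relE => /andP[].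
apply/subsetP=> y xy; rewrite part_of_relE; apply/andP.
by split; [apply: (subsetP (RP x)) | apply: (subsetP (RQ x))].
Qed.

Lemma refines_join P Q R :
  refines (part_join P Q) R = refines P R && refines Q R.
Proof.
apply/refinesP/andP=> [PQR|[/refinesP PR /refinesP QR] x].
  split; apply/refinesP=> x; apply/subsetP=> y xy; apply: (subsetP (PQR x));
    by rewrite part_of_relE; apply: connect1; rewrite /= xy ?orbT.
apply/subsetP=> y; rewrite part_of_relE => /connectP[p + ->].
elim: p x => [|u p IHp] x /=; first by rewrite blk_refl.
case/andP=> xu /IHp; suff /blk_eq-> : u \in blk R x by [].
by case/orP: xu; [apply: (subsetP (PR x)) | apply: (subsetP (QR x))].
Qed.

Lemma eq_rel_eqv : equivalence_rel (@eq_op V).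
Proof. by move=> x y z; split=> // /eqP->. Qed.

Definition part_bot : part := part_of_rel eq_rel_eqv.

Definition part_top : part :=
  @part_of_rel (fun _ _ => true) (fun _ _ _ => conj isT (fun _ => erefl)).

Lemma refines_bot P : refines part_bot P.
Proof.
apply/refinesP=> x; apply/subsetP=> y.
by rewrite part_of_relE => /eqP<-; apply: blk_refl.
Qed.

Lemma refines_top P : refines P part_top.
Proof. by apply/refinesP=> x; apply/subsetP=> y _; rewrite part_of_relE. Qed.

End Part.

Fact part_display : Order.disp_t. Proof. exact: Order.Disp tt tt. Qed.

HB.instance Definition _ (V : finType) :=
  Order.Le_isPOrder.Build part_display (part V)
    (@refines_refl V) (@refines_anti V) (@refines_trans V).
HB.instance Definition _ (V : finType) :=
  Order.POrder_MeetJoin_isLattice.Build part_display (part V)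
    (@refines_meet V) (@refines_join V).
HB.instance Definition _ (V : finType) :=
  Order.hasBottom.Build part_display (part V) (@refines_bot V).
HB.instance Definition _ (V : finType) :=
  Order.hasTop.Build part_display (part V) (@refines_top V).

Section BooleanSublattice.
Local Open Scope order_scope.
Context {d : Order.disp_t} {T : finTBLatticeType d}.
Implicit Types L : {set T}.

Definition sublattice L : Prop :=
  [/\ L != set0, Order.ClosedPredicates.meet_closed L & Order.ClosedPredicates.join_closed L].

(* The bounds of a sublattice need not be the bounds of T. *)
Definition sub_bot L : T := \meet_(x in L) x.
Definition sub_top L : T := \join_(x in L) x.

Definition distributive_in L : Prop :=
  {in L & &, forall x y z, x `&` (y `|` z) = (x `&` y) `|` (x `&` z)}.

Definition complemented_in L : Prop :=
  {in L, forall x, exists2 y, y \in L &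
    x `&` y = sub_bot L /\ x `|` y = sub_top L}.

Definition boolean_sublattice L : Prop :=
  [/\ sublattice L, distributive_in L & complemented_in L].

Definition atoms L : {set T} :=
  [set a in L | (sub_bot L < a) &&
                [forall x in L, ~~ ((sub_bot L < x) && (x < a))]].

Definition dimension L : nat := #|atoms L|.

End BooleanSublattice.

Section Trees.
Variable V : finType.

(* A graph on V is given by its set of edges; loops are excluded by
   simple_graph, since [set x; x] has a single element. *)
Implicit Types (E : {set {set V}}) (A : {set V}).

Definition simple_graph E : bool := [forall e in E, #|e| == 2].

Definition adj E : rel V := [rel x y | [set x; y] \in E].

Definition connected_nodes E A : bool :=
  (A != set0) &&
  [forall x in A, forall y in A,
    connect [rel u v | [&& u \in A, v \in A & adj E u v]] x y].

(* A walk back and forth along an edge is a ucycle of size 2. *)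
Definition acyclic E : Prop :=
  forall c : seq V, ucycle (adj E) c -> size c <= 2.

Definition is_tree E : Prop :=
  [/\ simple_graph E, connected_nodes E [set: V] & acyclic E].

Definition tree_lattice E : {set part V} :=
  [set P : part V | [forall B in blocks P, connected_nodes E B]].

End Trees.

(* Main.v *)
(* Call a set of edges independent if no edge has its two ends connected by the
   others, i.e. if the graph is a forest; a forest with [k] edges has [n - k]
   components, so [k <= n - 1], with equality for trees.  Sending a set of edges
   of a tree to its partition into components embeds a Boolean lattice of
   dimension [n - 1] into the partition lattice, with image the tree lattice.
   Conversely, in a Boolean sublattice choose for each atom [a] two nodes that
   [a] identifies and the bottom does not.  By distributivity [a] meets the join
   of any set of other atoms in the bottom, so these pairs are the edges of a
   forest and the dimension is at most [n - 1].  If the forest is a tree, every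
   [P] in the sublattice consists of the components of the edges chosen in the
   atoms below [P]: if [P] identified two nodes separated by removing the edge of
   another atom [a], the join of the atoms other than [a] would identify the ends
   of that edge. *)
Require Import Defs.
From mathcomp Require Import all_boot all_order.

Set Implicit Arguments.
Unset Strict Implicit.
Unset Printing Implicit Defensive.

Import Order.TTheory.

Local Notation blk P := (pblock (blocks P)).

(** * Partitions into the components of a graph *)

Section Components.
Variable V : finType.
Implicit Types (P Q : part V) (E F G : {set {set V}}) (e : {set V}) (x y z : V).

Lemma part_leP P Q :
  reflect (forall x y, y \in blk P x -> y \in blk Q x) (P <= Q)%O.
Proof.
apply: (iffP (refinesP P Q)) => PQ x; first by move=> y; apply: (subsetP (PQ x)).
by apply/subsetP=> y; apply: PQ.
Qed.

Lemma blk_trans P x y z : y \in blk P x -> z \in blk P y -> z \in blk P x.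
Proof. by move=> /blk_eq->. Qed.

Lemma blk_meet P Q x y :
  (y \in blk (P `&` Q)%O x) = (y \in blk P x) && (y \in blk Q x).
Proof. exact: part_of_relE. Qed.

Definition inside P e : bool := [exists z, e \subset blk P z].

Lemma inside2 P x y : inside P [set x; y] = (y \in blk P x).
Proof.
apply/existsP/idP=> [[z]|xy]; last first.
  by exists x; rewrite subUset !sub1set blk_refl.
by rewrite subUset !sub1set => /andP[xz yz]; rewrite (blk_eq xz).
Qed.

Lemma inside_le P Q e : (P <= Q)%O -> inside P e -> inside Q e.
Proof.
move=> /refinesP PQ /existsP[z ez]; apply/existsP; exists z.
exact: subset_trans ez (PQ z).
Qed.

Lemma inside_meet P Q e : #|e| == 2 ->
  inside P e -> inside Q e -> inside (P `&` Q)%O e.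
Proof.
case/cards2P=> x [y [_ ->]]; rewrite !inside2 blk_meet.
by move=> -> ->. Qed.

Lemma adjE E x y : adj E x y = ([set x; y] \in E).
Proof. by []. Qed.

Lemma adj_sym E : symmetric (adj E).
Proof. by move=> x y; rewrite !adjE setUC. Qed.

Lemma connect_adj_eqv E : equivalence_rel (connect (adj E)).
Proof.
move=> x y z; split=> [|xy]; first exact: connect0.
exact: (same_connect (sym_connect_sym (adj_sym E)) xy).
Qed.

Lemma comps_exist E :
  {P : part V | forall x y, (y \in blk P x) = connect (adj E) x y}.
Proof. by exists (part_of_rel (connect_adj_eqv E)) => x y; apply: part_of_relE. Qed.

(* Defined through an opaque proof so that [/=] and unification do not unfold it. *)
Definition comps E : part V := sval (comps_exist E).

Lemma blk_comps E x y : (y \in blk (comps E) x) = connect (adj E) x y.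
Proof. exact: svalP (comps_exist E) x y. Qed.

Lemma connect_blk (r : rel V) P :
  (forall x y, r x y -> y \in blk P x) ->
  forall x y, connect r x y -> y \in blk P x.
Proof.
move=> rP x y /connectP[p + ->]; elim: p x => [|u p IHp] x /=.
  by rewrite blk_refl.
by case/andP=> /rP xu /IHp; apply: blk_trans.
Qed.

Lemma simple_sub E F : F \subset E -> simple_graph E -> simple_graph F.
Proof.
by move=> /subsetP FE /forall_inP sE; apply/forall_inP=> e /FE/sE.
Qed.

Lemma comps_le E P :
  (forall e, e \in E -> inside P e) -> (comps E <= P)%O.
Proof.
move=> EP; apply/part_leP=> x y; rewrite blk_comps; apply: connect_blk => u v.
by move=> /EP; rewrite inside2.
Qed.

Lemma inside_comps E e : #|e| == 2 -> e \in E -> inside (comps E) e.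
Proof.
by case/cards2P=> x [y [_ ->]] eE; rewrite inside2 blk_comps; apply: connect1.
Qed.

Lemma comps_mono E F : F \subset E -> (comps F <= comps E)%O.
Proof.
move=> /subsetP FE; apply/part_leP=> x y; rewrite !blk_comps.
by apply: connect_sub => u v uv; apply: connect1; apply: FE.
Qed.

Lemma comps0 : comps set0 = \bot%O.
Proof. by apply/le_anti; rewrite le0x andbT; apply: comps_le => e; rewrite inE. Qed.

Lemma compsU E F : simple_graph (E :|: F) ->
  comps (E :|: F) = (comps E `|` comps F)%O.
Proof.
move=> /forall_inP sEF; apply/le_anti/andP; split; last first.
  by rewrite leUx (comps_mono (subsetUl E F)) (comps_mono (subsetUr E F)).
apply: comps_le => e eEF; have e2 := sEF e eEF.
case/setUP: eEF => eE; apply: inside_le (inside_comps e2 eE); first exact: leUl.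
exact: leUr.
Qed.

Lemma set2_eq x y u v : [set x; y] = [set u; v] ->
  x = u /\ y = v \/ x = v /\ y = u.
Proof.
move=> eq_xyuv.
have: x \in [set u; v] by rewrite -eq_xyuv set21.
have: y \in [set u; v] by rewrite -eq_xyuv set22.
have: u \in [set x; y] by rewrite eq_xyuv set21.
have: v \in [set x; y] by rewrite eq_xyuv set22.
by rewrite !inE => /orP[]/eqP-> /orP[]/eqP-> /orP[]/eqP? /orP[]/eqP?; subst; auto.
Qed.

(** A walk crosses the new edge either not at all or, after cutting out returns, once; the last two
    disjuncts are the two directions of the crossing. *)
Lemma blk_compsU1 E u v x y (C := comps E) :
  (y \in blk (comps ([set u; v] |: E)) x) =
  [|| y \in blk C x, (u \in blk C x) && (y \in blk C v)
    | (v \in blk C x) && (y \in blk C u)].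
Proof.
set C' := comps _.
have leC : (C <= C')%O by apply: comps_mono; apply: subsetUr.
have CC' s t : t \in blk C s -> t \in blk C' s by apply/part_leP.
have uv : v \in blk C' u by rewrite blk_comps; apply: connect1; apply: setU11.
have vu : u \in blk C' v by rewrite blk_sym.
apply/idP/or3P; last first.
  case=> [/CC'//|/andP[/CC' xu /CC' vy]|/andP[/CC' xv /CC' uy]].
    exact: blk_trans xu (blk_trans uv vy).
  exact: blk_trans xv (blk_trans vu uy).
rewrite blk_comps => /connectP[p + ->].
elim: p x => [|w p IHp] x /=.
  by move=> _; constructor 1; apply: blk_refl.
case/andP=> /setU1P[/set2_eq xw|xw] /IHp.
  case: xw => -[-> ->] [wy|/andP[wu vy]|/andP[wv uy]].
  - by constructor 2; rewrite blk_refl ?vy ?uy.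
  - by constructor 2; rewrite blk_refl ?vy ?uy.
  - by constructor 1.
  - by constructor 3; rewrite blk_refl ?vy ?uy.
  - by constructor 1.
  by constructor 3; rewrite blk_refl ?vy ?uy.
have /blk_eq-> // : w \in blk C x by rewrite blk_comps; apply: connect1.
Qed.

(* If removing [e] from [E] disconnects [x] from [y], then the ends of [e] are
   connected, away from [e], to [x] and [y] respectively. *)
Lemma exchange E e Q x y : #|e| == 2 -> e \in E ->
  y \in blk (comps E) x -> y \notin blk (comps (E :\ e)) x ->
  (comps (E :\ e) <= Q)%O -> y \in blk Q x -> inside Q e.
Proof.
case/cards2P=> u [v [_ ->]] eE; rewrite -{1}(setD1K eE) blk_compsU1.
move=> + /negPf N; rewrite N /= => H /part_leP leQ xy; rewrite inside2.
case/orP: H => /andP[/leQ xu /leQ vy].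
  apply: (blk_trans (y := x)); first by rewrite blk_sym.
  by apply: blk_trans xy _; rewrite blk_sym.
rewrite blk_sym; apply: (blk_trans (y := x)); first by rewrite blk_sym.
by apply: blk_trans xy _; rewrite blk_sym.
Qed.

(** * Independent edge sets *)

Definition indep E : Prop := forall e, e \in E -> ~~ inside (comps (E :\ e)) e.

Lemma indep_sub E F : F \subset E -> indep E -> indep F.
Proof.
move=> FE iE e eF; apply: contra (iE e (subsetP FE e eF)).
by apply: inside_le; apply: comps_mono; apply: setSD.
Qed.

(** An edge of [E] outside [F] leaves [F] within [E :\ e], where independence keeps its ends apart.
    Hence [F] can be read off from [comps F]. *)
Lemma inside_comps_indep E F e : simple_graph E -> indep E -> F \subset E ->
  e \in E -> inside (comps F) e = (e \in F).
Proof.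
move=> /forall_inP sE iE FE eE; apply/idP/idP=> [eF|]; last exact/inside_comps/sE.
apply: contraLR (iE e eE) => NeF; rewrite negbK.
by apply: inside_le eF; apply: comps_mono; rewrite subsetD1 FE.
Qed.

Lemma comps_inj E : simple_graph E -> indep E ->
  {in powerset E &, injective comps}.
Proof.
move=> sE iE F G; rewrite !inE => FE GE eqFG; apply/setP=> e.
have [eE|NeE] := boolP (e \in E).
  rewrite -(inside_comps_indep sE iE FE eE) eqFG.
  exact: (inside_comps_indep sE).
by rewrite (contraNF (subsetP FE e) NeE) (contraNF (subsetP GE e) NeE).
Qed.

(** In a forest the path from [x] to [y] consists of the edges whose removal separates them, so [F]
    connects them once it contains all of these. A minimal connecting set between [F] and [E] stands
    in for the path. *)
Lemma comps_cut E F x y : simple_graph E -> indep E -> F \subset E ->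
  y \in blk (comps E) x ->
  (forall e, e \in E -> e \notin F -> y \in blk (comps (E :\ e)) x) ->
  y \in blk (comps F) x.
Proof.
move=> /forall_inP sE iE FE xyE cutE.
pose conn G := [&& F \subset G, G \subset E & y \in blk (comps G) x].
have /minset_exists[G] : conn E by apply/and3P.
case/minsetP=> /and3P[FG GE xyG] minG _.
suff GF : G \subset F by have /eqP-> : F == G by rewrite eqEsubset FG.
apply/subsetP=> e eG; apply/negPn/negP=> NeF.
have eE := subsetP GE e eG.
have := iE e eE; apply/negP/negPn.
(* By minimality [e] is a bridge of [G] between [x] and [y], yet they are connected in [E :\ e]; so
   the ends of [e] would be too. *)
apply: exchange (eG) xyG _ (comps_mono (setSD _ GE)) (cutE e eE NeF); first exact: sE.
apply/negP=> xyGe; have /setP/(_ e) : G :\ e = G.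
  apply: minG (subD1set _ _); apply/and3P; split=> //.
    by rewrite subsetD1 FG.
  exact: subset_trans (subD1set _ _) GE.
by rewrite setD11 eG.
Qed.

(** Nodes connected in both [F] and [G] stay connected after removing any edge missing from one of
    the two, so [comps_cut] applies to [F :&: G]. *)
Lemma compsI E F G : simple_graph E -> indep E -> F \subset E -> G \subset E ->
  comps (F :&: G) = (comps F `&` comps G)%O.
Proof.
move=> sE iE FE GE; apply/le_anti/andP; split.
  by rewrite lexI (comps_mono (subsetIl F G)) (comps_mono (subsetIr F G)).
apply/part_leP=> x y; rewrite blk_meet => /andP[xyF xyG].
have sub (H K : {set {set V}}) : H \subset K -> y \in blk (comps H) x -> y \in blk (comps K) x.
  by move=> HK; apply/part_leP/comps_mono.
apply: comps_cut sE iE _ (sub _ _ FE xyF) _; first by rewrite subIset ?FE.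
move=> e eE; rewrite inE negb_and => /orP[Ne|Ne].
  by apply: sub xyF; rewrite subsetD1 FE.
by apply: sub xyG; rewrite subsetD1 GE.
Qed.

(** The map [f] labels components, so its image counts them: a forest has as many components as
    nodes minus edges. Each edge added merges two labels. *)
Lemma indep_kernel E : simple_graph E -> indep E ->
  exists2 f : V -> V, forall x y, (y \in blk (comps E) x) = (f x == f y)
    & #|f @: [set: V]| + #|E| = #|V|.
Proof.
have [n] := ubnP #|E|; elim: n E => // n IHn E.
have [->|[e eE]] := set_0Vmem E.
  move=> _ _ _; exists id; last by rewrite imset_id cards0 addn0 cardsT.
  by move=> x y; rewrite comps0 part_of_relE.
rewrite (cardsD1 e) eE ltnS => leEn sE iE; pose E' := E :\ e.
have E'E : E' \subset E := subD1set E e.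
have [f fE cardf] := IHn E' leEn (simple_sub E'E sE) (indep_sub E'E iE).
have /cards2P[u [v [_ def_e]]] := forall_inP sE e eE.
have := iE e eE; rewrite {2}def_e inside2 fE => Nfuv.
(* The component of [u] takes the label of the component of [v]. The labels differ by independence,
   so the image loses exactly [f u]. *)
exists (fun x => if f x == f u then f v else f x) => [x y|].
  have defE : E = [set u; v] |: E' by rewrite -def_e setD1K.
  rewrite [in LHS]defE blk_compsU1 !fE.
  by have [->|/negPf xu] := eqVneq (f x) (f u);
     have [->|yu] := eqVneq (f y) (f u); rewrite ?xu ?eqxx ?andbT ?andbF ?orbF.
rewrite -cardf addnA; congr (_ + _).
rewrite addnC [RHS](cardsD1 (f u)) imset_f ?inE //; congr (_ + _).
apply: eq_card => z; apply/imsetP/setD1P=> [[x _ ->]|[Nz /imsetP[x _ def_z]]].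
  by have [_|xu] := eqVneq (f x) (f u); rewrite imset_f ?inE // eq_sym.
by exists x => //; rewrite -def_z (negPf Nz).
Qed.

Lemma indep_card E : 0 < #|V| -> simple_graph E -> indep E -> #|E| <= #|V|.-1.
Proof.
move=> /card_gt0P[x _] sE iE; have [f _ <-] := indep_kernel sE iE.
have: 0 < #|f @: [set: V]| by apply/card_gt0P; exists (f x); rewrite imset_f ?inE.
by case: #|_| => // k _; rewrite addSn /= leq_addl.
Qed.

Lemma indep_connected E : simple_graph E -> indep E -> 0 < #|V| ->
  (#|E| == #|V|.-1) = (comps E == \top%O).
Proof.
move=> sE iE /card_gt0P[x0 _]; have [f fE <-] := indep_kernel sE iE.
have imf x : f x \in f @: [set: V] by rewrite imset_f ?inE.
have -> : (comps E == \top%O) = (#|f @: [set: V]| == 1).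
  apply/eqP/cards1P=> [cE|[z fz]].
    exists (f x0); apply/setP=> z; rewrite inE.
    apply/imsetP/eqP=> [[x _ ->]|->]; last by exists x0.
    by apply/eqP; rewrite -fE cE part_of_relE.
  apply/le_anti; rewrite lex1; apply/part_leP=> x y _; rewrite fE.
  by have := imf x; have := imf y; rewrite fz !inE => /eqP-> /eqP->.
have: 0 < #|f @: [set: V]| by apply/card_gt0P; exists (f x0).
case: #|_| => // k _; rewrite addSn /= eqSS -{1}[#|E|]add0n eqn_add2r.
exact: eq_sym.
Qed.

(** * Trees as connected independent graphs, and their lattices *)

Lemma acyclic_indep E : simple_graph E -> acyclic E -> indep E.
Proof.
move=> /forall_inP sE acE e eE; have /cards2P[x [y [Nxy def_e]]] := sE e eE.
rewrite {2}def_e inside2 blk_comps; apply/negP=> /connectP[p0 p0P y_last].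
case/shortenP: p0P y_last => p pP Up _ def_y.
have subE : subrel (adj (E :\ e)) (adj E) by move=> u v /setD1P[].
have /acE : ucycle (adj E) (x :: p).
  rewrite /ucycle Up andbT /= rcons_path (sub_path subE pP) -def_y.
  by rewrite adj_sym adjE -def_e.
(* The edge [e] closes the path to a cycle, so the path has at most one step. No step would give
   [x = y]; a single step would be [e] itself, which was removed. *)
case: p pP Up def_y => [|z [|w p]] // pP _ def_y _.
  by rewrite def_y eqxx in Nxy.
by case/andP: pP; rewrite adjE (_ : z = y) // -def_e setD11.
Qed.

Lemma indep_acyclic E : indep E -> acyclic E.
Proof.
move=> iE [|x [|y [|z c]]] // /andP[+ +] => /=.
move=> /and3P[xy yz zc]; rewrite !inE !negb_or => /andP[/and3P[Nxy Nxz Nxc]].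
case/andP=> /andP[Nyz Nyc] _; have := iE _ xy.
suff: connect (adj (E :\ [set x; y])) y x by rewrite inside2 -blk_comps blk_sym => ->.
(* An edge survives the removal of [[set x; y]] if it avoids [x] or avoids [y]. The edge from [y] to
   [z] avoids [x]; the rest of the cycle back to [x] avoids [y]. *)
have step u v : adj E u v -> (u != x) && (v != x) || (u != y) && (v != y) ->
    adj (E :\ [set x; y]) u v.
  move=> uv H; rewrite adjE in_setD1 [_ \in E]uv andbT; apply/eqP=> /set2_eq[][? ?]; subst;
  by move: H; rewrite !eqxx ?andbF.
apply: (connect_trans (y := z)).
  by apply: connect1; apply: step; rewrite // ![_ == x]eq_sym Nxy Nxz.
apply/connectP; exists (rcons c x); last by rewrite last_rcons.
have: z != y by rewrite eq_sym.
elim: c z zc Nyc {Nyz yz Nxz Nxc} => [|w c IHc] z /=.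
  by rewrite !andbT => zx _ Nzy; apply: step; rewrite // Nzy Nxy orbT.
case/andP=> zw wc; rewrite inE negb_or eq_sym => /andP[Nwy Nyc] Nzy.
by rewrite (step z w) ?Nwy ?Nzy ?orbT //= IHc.
Qed.

Lemma connected_nodesT E : 0 < #|V| ->
  connected_nodes E [set: V] = (comps E == \top%O).
Proof.
move=> V_gt0; have eqr : [rel u v | [&& u \in [set: V], v \in [set: V] & adj E u v]]
    =2 adj E by move=> u v; rewrite /= !inE.
rewrite /connected_nodes -cards_eq0 cardsT -lt0n V_gt0 /=.
apply/forall_inP/eqP=> [cE|cE x _].
  apply/le_anti; rewrite lex1; apply/part_leP=> x y _.
  by have /forall_inP/(_ y (in_setT y)) := cE x (in_setT x); rewrite (eq_connect eqr) blk_comps.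
by apply/forall_inP=> y _; rewrite (eq_connect eqr) -blk_comps cE part_of_relE.
Qed.

Lemma is_treeP E : 0 < #|V| ->
  is_tree E <-> [/\ simple_graph E, comps E = \top%O & indep E].
Proof.
move=> V_gt0; rewrite /is_tree connected_nodesT //; split=> [][sE /eqP cE]; split=> //.
  exact: acyclic_indep.
exact: indep_acyclic.
Qed.

(** Connected blocks are held together by the edges of [E] inside them, so these edges serve as [F].
    Conversely, a walk along edges of [F] never leaves its component. *)
Lemma tree_latticeP E P : simple_graph E ->
  reflect (exists2 F : {set {set V}}, F \subset E & P = comps F)
    (P \in tree_lattice E).
Proof.
move=> /forall_inP sE; rewrite inE; apply: (iffP forall_inP) => [cP|[F FE ->] B BF].
  pose F := [set e in E | inside P e].
  exists F; first by apply/subsetP=> e; rewrite inE => /andP[].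
  apply/le_anti/andP; split; last by apply: comps_le => e; rewrite inE => /andP[].
  apply/part_leP=> x y xy; have /andP[_ /forall_inP] := cP _ (blk_in P x).
  move=> /(_ x (blk_refl P x))/forall_inP/(_ y xy).
  apply: connect_blk => u v /and3P[ux vx uv].
  rewrite blk_comps; apply: connect1; rewrite adjE inE [_ \in E]uv.
  apply/existsP; exists x.
  by rewrite subUset !sub1set ux vx.
have [x xB] := set0Pn _ (partition_neq0 (partP (comps F)) BF).
apply/andP; split; first by apply/set0Pn; exists x.
apply/forall_inP=> y yB; apply/forall_inP=> z.
rewrite -(blk_def BF yB) blk_comps; set r := [rel u v | _] => /connectP[p].
suff step w : w \in blk (comps F) y -> path (adj F) w p -> z = last w p ->
    connect r w z by apply: step; apply: blk_refl.
elim: p w => [|u p IHp] w wy /=.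
  by move=> _ ->; apply: connect0.
case/andP=> wu uz def_z.
have uy : u \in blk (comps F) y.
  by apply: blk_trans wy _; rewrite blk_comps connect1.
apply: connect_trans (IHp u uy uz def_z); apply: connect1.
by rewrite /= wy uy; apply: (subsetP FE).
Qed.

End Components.

(** * Atoms of a Boolean sublattice of a finite lattice *)

Section BooleanSublatticeTheory.
Local Open Scope order_scope.
Context {d : Order.disp_t} {T : finTBLatticeType d}.
Implicit Types (L S : {set T}) (a x y : T).

Lemma sub_bot_le L x : x \in L -> sub_bot L <= x.
Proof. exact: meets_inf. Qed.

Lemma le_sub_top L x : x \in L -> x <= sub_top L.
Proof. exact: joins_sup. Qed.

Lemma sub_bot_in L : sublattice L -> sub_bot L \in L.
Proof.
case=> /set0Pn[x0 x0L] LI _; rewrite -(meet_r (sub_bot_le x0L)).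
(* The iterated meet starts from the top of [T], which may lie outside [L]; the invariant therefore
   always meets with an element of [L]. *)
pose K y := forall x, x \in L -> x `&` y \in L.
rewrite /sub_bot; apply: (big_ind K) x0 x0L => [x|y z Ky Kz x|y yL x] xL.
- by rewrite meetx1.
- by rewrite meetA; apply/Kz/Ky.
exact: LI.
Qed.

(** The term [sub_bot L] keeps the value in [L] when [S] is empty, since the bottom of [T] may lie
    outside [L]. *)
Definition sub_join L S : T := sub_bot L `|` \join_(a in S) a.

Lemma sub_join_in L S : sublattice L -> S \subset L -> sub_join L S \in L.
Proof.
move=> latL /subsetP SL; have [_ _ LU] := latL; have := sub_bot_in latL.
pose K y := forall x, x \in L -> x `|` y \in L.
rewrite /sub_join; apply: (big_ind K) (sub_bot L) => [x|y z Ky Kz x|y yS x] xL.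
- by rewrite joinx0.
- by rewrite joinA; apply/Kz/Ky.
exact: LU (SL y yS).
Qed.

Lemma le_sub_join L S a : a \in S -> a <= sub_join L S.
Proof. by move=> aS; rewrite lexU2 // (joins_sup _ aS) orbT. Qed.

Lemma sub_join_le L S x :
  x \in L -> (forall a, a \in S -> a <= x) -> sub_join L S <= x.
Proof. by move=> xL Sx; rewrite leUx sub_bot_le //; apply/joinsP. Qed.

Lemma atomsP L a : reflect
  [/\ a \in L, sub_bot L < a & forall x, x \in L -> sub_bot L < x -> ~~ (x < a)]
  (a \in atoms L).
Proof.
rewrite inE; apply: (iffP and3P) => [][aL ba].
  move=> /forall_inP minA; split=> // x xL bx.
  by apply: contra (minA x xL) => ->; rewrite bx.
by move=> minA; split=> //; apply/forall_inP=> x xL; apply/andP=> -[/(minA x xL)/negP].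
Qed.

Lemma atoms_sub L : atoms L \subset L.
Proof. by apply/subsetP=> a /atomsP[]. Qed.

Lemma exists_atom L x : x \in L -> x != sub_bot L ->
  exists2 a, a \in atoms L & a <= x.
Proof.
move=> xL Nx0; pose K y := [&& y \in L, sub_bot L < y & y <= x].
have Kx : K x by rewrite /K xL lexx lt_def Nx0 sub_bot_le.
(* An element of [K] with the fewest elements of [L] below it is minimal, hence an atom. *)
case: (arg_minnP (fun y => #|[set z in L | z <= y]|) Kx) => a /and3P[aL ba ax] minA.
exists a => //; apply/atomsP; split=> // y yL by_; apply/negP=> ya.
have /minA : K y by rewrite /K yL by_ (le_trans (ltW ya) ax).
rewrite leqNgt => /negP; apply; apply: proper_card.
apply/properP; split.
  by apply/subsetP=> z; rewrite !inE => /andP[-> zy]; apply: le_trans zy (ltW ya).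
by exists a; rewrite !inE aL ?lexx //= lt_geF.
Qed.

Lemma meet_atoms L a x : sublattice L -> a \in atoms L -> x \in L ->
  ~~ (a <= x) -> a `&` x = sub_bot L.
Proof.
case=> _ LI _ /atomsP[aL ba minA] xL Nax; apply/eqP/negPn/negP=> Nax0.
have axL := LI _ _ aL xL.
have /(minA _ axL)/negP[] : sub_bot L < a `&` x by rewrite lt_def Nax0 sub_bot_le.
by rewrite lt_neqAle leIl andbT eq_meetl.
Qed.

Lemma atom_le_atom L a x : a \in atoms L -> x \in atoms L -> a <= x -> a = x.
Proof.
move=> /atomsP[aL ba _] /atomsP[_ _ /(_ a aL ba)].
by rewrite lt_neqAle negb_and negbK => /orP[/eqP|/negP].
Qed.

(** Distinct atoms meet in the bottom, and distributivity carries this over to joins. *)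
Lemma meet_atom_sub_join L S a : boolean_sublattice L -> a \in atoms L ->
  S \subset atoms L -> a \notin S -> a `&` sub_join L S = sub_bot L.
Proof.
case=> latL distL _ aA /subsetP SA NaS; have [_ _ LU] := latL.
have bL := sub_bot_in latL; have aL := subsetP (atoms_sub L) a aA.
pose K y := sub_bot L `|` y \in L /\ a `&` (sub_bot L `|` y) = sub_bot L.
suff [] : K (\join_(b in S) b) by [].
apply: (big_ind K) => [|y z [yL ay] [zL az]|b bS].
- by rewrite /K joinx0; split=> //; apply/meet_r/sub_bot_le.
(* Doubling [sub_bot L] gives each of [y] and [z] its own copy, so that both joins lie in [L] and
   distributivity applies. *)
- rewrite /K -[sub_bot L in X in X /\ _]joinxx -[sub_bot L in X in a `&` X]joinxx.
  by rewrite joinACA distL // ay az joinxx; split=> //; apply: LU.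
have bA := SA b bS; have bbL := subsetP (atoms_sub L) b bA.
rewrite /K (join_r (sub_bot_le bbL)); split=> //; apply: meet_atoms => //.
by apply: contra NaS => /(atom_le_atom aA bA)->.
Qed.

Lemma atoms_le_sub_join L S : boolean_sublattice L -> S \subset atoms L ->
  [set a in atoms L | a <= sub_join L S] = S.
Proof.
move=> boolL SA; apply/setP=> a; rewrite inE.
apply/andP/idP=> [[aA aS]|aS]; last by rewrite (subsetP SA) // le_sub_join.
apply/negPn/negP=> NaS; have /atomsP[_ + _] := aA.
by rewrite -(meet_atom_sub_join boolL aA SA NaS) (meet_l aS) ltxx.
Qed.

(** Let [z'] be a complement of the join [z]. An atom below [x] and [z'] would also be below [z],
    hence below the bottom. So [x] meets [z'] in the bottom, and distributing [x] over the join of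
    [z] and [z'] gives [x = z]. *)
Lemma sub_join_atoms L x : boolean_sublattice L -> x \in L ->
  sub_join L [set a in atoms L | a <= x] = x.
Proof.
move=> [latL distL compL] xL; set S := [set _ in _ | _]; set z := sub_join L S.
have [_ LI _] := latL.
have SL : S \subset L.
  by apply: subset_trans (atoms_sub L); apply/subsetP=> a; rewrite inE => /andP[].
have zL : z \in L by apply: sub_join_in.
have zx : z <= x by apply: sub_join_le => // a; rewrite inE => /andP[].
have [z' z'L [zz'0 zz'1]] := compL z zL.
have xz'L := LI _ _ xL z'L.
suff xz' : x `&` z' = sub_bot L.
  rewrite -[RHS](meet_l (le_sub_top xL)) -zz'1 distL // xz' (meet_r zx).
  by rewrite (join_l (sub_bot_le zL)).
apply/eqP/negPn/negP=> /(exists_atom xz'L)[a aA]; rewrite lexI => /andP[ax az'].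
have /atomsP[_ ba _] := aA; suff ab : a <= sub_bot L by rewrite (le_gtF ab) in ba.
rewrite -zz'0 lexI az' andbT.
by apply: le_sub_join; rewrite inE aA.
Qed.

Lemma card_boolean L : boolean_sublattice L -> (#|L| <= 2 ^ dimension L)%N.
Proof.
move=> boolL; rewrite /dimension -card_powerset.
pose g x := [set a in atoms L | a <= x].
have /card_in_imset <- : {in L &, injective g}.
  by move=> x y xL yL gxy; rewrite -(sub_join_atoms boolL xL) -/(g x) gxy sub_join_atoms.
apply: subset_leq_card; apply/subsetP=> _ /imsetP[x _ ->]; rewrite inE.
by apply/subsetP=> a; rewrite inE => /andP[].
Qed.

End BooleanSublatticeTheory.

(** * Tree lattices are Boolean and determine their trees *)

Section TreeLattices.
Variable V : finType.
Hypothesis V_gt0 : 0 < #|V|.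
Implicit Types (L : {set part V}) (P Q : part V) (E F G H : {set {set V}}).

(** On subsets of [E], [comps] turns unions into joins and intersections into meets, so the Boolean
    laws transfer from the power set of [E]. *)
Lemma tree_boolean E : is_tree E -> boolean_sublattice (tree_lattice E).
Proof.
move=> /(is_treeP _ V_gt0)[sE cE iE].
have latP P := tree_latticeP P sE.
have subU F G : F \subset E -> G \subset E -> F :|: G \subset E.
  by rewrite subUset => -> ->.
have subI F G : F \subset E -> F :&: G \subset E by move=> FE; rewrite subIset ?FE.
have cU F G : F \subset E -> G \subset E ->
    comps (F :|: G) = (comps F `|` comps G)%O.
  by move=> FE GE; apply: compsU; apply: simple_sub sE; apply: subU.
have cI F G : F \subset E -> G \subset E ->
    comps (F :&: G) = (comps F `&` comps G)%O by apply: compsI.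
have bot_in : \bot%O \in tree_lattice E.
  by apply/latP; exists set0; rewrite ?sub0set ?comps0.
have top_in : \top%O \in tree_lattice E by apply/latP; exists E.
have botE : sub_bot (tree_lattice E) = \bot%O.
  by apply/le_anti; rewrite le0x andbT; apply: sub_bot_le.
have topE : sub_top (tree_lattice E) = \top%O.
  by apply/le_anti; rewrite lex1; apply: le_sub_top.
split.
- split; first by apply/set0Pn; exists \bot%O.
    move=> P Q /latP[F FE ->] /latP[G GE ->].
    by apply/latP; exists (F :&: G); [apply: subI | rewrite cI].
  move=> P Q /latP[F FE ->] /latP[G GE ->].
  by apply/latP; exists (F :|: G); [apply: subU | rewrite cU].
- move=> P Q R /latP[F FE ->] /latP[G GE ->] /latP[H HE ->].
  rewrite -(cU _ _ GE HE) -(cI _ _ FE (subU _ _ GE HE)) setIUr.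
  by rewrite (cU _ _ (subI _ _ FE) (subI _ _ FE)) (cI _ _ FE GE) (cI _ _ FE HE).
move=> P /latP[F FE ->]; have DE : E :\: F \subset E by apply: subsetDl.
exists (comps (E :\: F)); first by apply/latP; exists (E :\: F).
rewrite botE topE -cI // -cU // -cE -comps0; split; congr comps.
  by apply/setP=> e; rewrite !inE; case: (e \in F).
by apply/setP=> e; rewrite !inE; case: (boolP (e \in F)) => // /(subsetP FE)->.
Qed.

Lemma card_tree_lattice E : is_tree E -> 2 ^ #|V|.-1 <= #|tree_lattice E|.
Proof.
move=> /(is_treeP _ V_gt0)[sE cE iE].
have /eqP<- : #|E| == #|V|.-1 by rewrite indep_connected // cE.
rewrite -card_powerset -(card_in_imset (comps_inj sE iE)).
apply: subset_leq_card; apply/subsetP=> _ /imsetP[F FE ->].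
by apply/tree_latticeP => //; exists F; rewrite // -powersetE.
Qed.

(** For an edge [e] of [E], the partition [comps [set e]] equals [comps F] for some [F] within [E'].
    Its only nontrivial block is [e], so [F] is nonempty and its edges can only be [e]. *)
Lemma tree_lattice_sub E E' : simple_graph E -> simple_graph E' ->
  tree_lattice E = tree_lattice E' -> E \subset E'.
Proof.
move=> /[dup] sE /forall_inP s2E sE' eqL; apply/subsetP=> e eE.
have : comps [set e] \in tree_lattice E' .
  by rewrite -eqL; apply/tree_latticeP => //; exists [set e]; rewrite ?sub1set.
case/(tree_latticeP _ sE')=> F FE' def_e.
have e2 := s2E e eE; have := inside_comps e2 (set11 e).
rewrite def_e; case/cards2P: e2 => x [y [Nxy exy]].
have [->|[e' e'F]] := set_0Vmem F.
  by rewrite comps0 exy inside2 part_of_relE (negPf Nxy).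
have e'E' := subsetP FE' e' e'F.
have /cards2P[u [v [Nuv euv]]] := forall_inP sE' e' e'E'.
have : inside (comps [set e]) e'.
  by rewrite def_e; apply: inside_comps => //; apply: forall_inP sE' e' e'E'.
rewrite -[[set e]]setU0 {1}exy {1}euv inside2 blk_compsU1 comps0 !part_of_relE.
rewrite (negPf Nuv) /= => H _; suff -> : e = e' by [].
rewrite exy euv; case/orP: H => /andP[/eqP-> /eqP->]; last exact: setUC.
by [].
Qed.

Lemma exists_tree : exists E : {set {set V}}, is_tree E.
Proof.
have /card_gt0P[r _] := V_gt0.
(* The star with centre [r]. *)
pose E := [set [set r; x] | x in [set~ r]]; exists E; apply/(is_treeP _ V_gt0).
have EP e : reflect (exists2 x, r != x & e = [set r; x]) (e \in E).
  by apply: (iffP imsetP) => -[x]; rewrite ?inE => Nx ->; exists x; rewrite ?inE // eq_sym.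
split.
- by apply/forall_inP=> _ /EP[x Nx ->]; rewrite cards2 Nx.
- apply/le_anti; rewrite lex1; apply/part_leP=> x y _.
  have rE z : z \in blk (comps E) r.
    have [<-|Nz] := eqVneq r z; first exact: blk_refl.
    by rewrite blk_comps; apply: connect1; apply/EP; exists z.
  by apply: blk_trans (rE y); rewrite blk_sym.
move=> _ /EP[x Nx ->]; rewrite inside2.
(* The partition into the leaf [x] and all other nodes: every other edge of the star lies in one of
   its blocks, the removed edge does not. *)
have eqv_x : equivalence_rel [rel u v | (u == x) == (v == x)].
  by move=> u v w /=; split=> // /eqP->.
suff : (comps (E :\ [set r; x]) <= part_of_rel eqv_x)%O.
  by move/part_leP=> le_x; apply/negP=> /le_x; rewrite part_of_relE /= eqxx (negPf Nx).
apply: comps_le => e /setD1P[Ne /EP[z Nz def_e]].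
rewrite def_e inside2 part_of_relE /= (negPf Nx); apply/eqP/esym/negbTE.
by apply: contra Ne => /eqP zx; rewrite def_e zx.
Qed.

(** * From a Boolean sublattice to a forest *)

Section Atoms.
Variable L : {set part V}.
Hypothesis boolL : boolean_sublattice L.

Lemma atom_edges : exists f : part V -> {set V}, forall a, a \in atoms L ->
  [/\ #|f a| == 2, inside a (f a) & ~~ inside (sub_bot L) (f a)].
Proof.
apply: (@fin_all_exists (part V) (fun=> {set V}) (fun a e => a \in atoms L ->
  [/\ #|e| == 2, inside a e & ~~ inside (sub_bot L) e])) => a.
have [aA|] := boolP (a \in atoms L); last by exists set0.
have /atomsP[_ ba _] := aA.
suff /existsP[x /existsP[y /andP[axy bxy]]] :
    [exists x, exists y, (y \in blk a x) && (y \notin blk (sub_bot L) x)].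
  exists [set x; y] => _; rewrite !inside2 cards2; split=> //.
  by have -> : x != y by apply: contraNneq bxy => <-; apply: blk_refl.
apply: contraTT ba => /existsPn Nex; rewrite le_gtF //.
apply/part_leP=> x y axy; have /existsPn/(_ y) := Nex x.
by rewrite axy negbK.
Qed.

Variable f : part V -> {set V}.
Hypothesis fP : forall a, a \in atoms L ->
  [/\ #|f a| == 2, inside a (f a) & ~~ inside (sub_bot L) (f a)].

(** An edge inside both [a] and the join would be inside their meet, the bottom, against the choice
    of [f a]. *)
Lemma edge_not_inside a (S : {set part V}) : a \in atoms L ->
  S \subset atoms L -> a \notin S -> ~~ inside (sub_join L S) (f a).
Proof.
move=> aA SA NaS; have [fa2 afa] := fP aA; apply: contra => Sfa.
by rewrite -(meet_atom_sub_join boolL aA SA NaS) inside_meet.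
Qed.

Lemma edge_inj : {in atoms L &, injective f}.
Proof.
move=> a b aA bA fab; apply/eqP/negPn/negP=> Nab.
have := @edge_not_inside a [set b] aA; rewrite sub1set in_set1 => /(_ bA Nab)/negP[].
have [_ bfb _] := fP bA; rewrite fab; apply: inside_le bfb.
by apply: le_sub_join; apply: set11.
Qed.

Let E := f @: atoms L.

Lemma edges_simple : simple_graph E.
Proof. by apply/forall_inP=> _ /imsetP[a /fP[? _ _] ->]. Qed.

Lemma comps_edges_le a :
  a \in atoms L -> (comps (E :\ f a) <= sub_join L (atoms L :\ a))%O.
Proof.
move=> aA; apply: comps_le => e /setD1P[+ /imsetP[b bA def_e]].
rewrite {e}def_e => Nfa; have [_ bfb _] := fP bA; apply: inside_le bfb.
by apply: le_sub_join; rewrite in_setD1 bA andbT; apply: contraNneq Nfa => ->.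
Qed.

Lemma edges_indep : indep E.
Proof.
move=> _ /imsetP[a aA ->]; apply: contra (_ : ~~ inside (sub_join L (atoms L :\ a)) _).
  exact/inside_le/comps_edges_le.
by apply: edge_not_inside; rewrite ?subsetDl ?setD11.
Qed.

Lemma card_edges : #|E| = dimension L.
Proof. exact: card_in_imset edge_inj. Qed.

Lemma boolean_comps P : comps E = \top%O -> P \in L ->
  P = comps (f @: [set a in atoms L | (a <= P)%O]).
Proof.
move=> cE PL; set S := [set _ in _ | _].
have SA : S \subset atoms L by apply/subsetP=> a; rewrite inE => /andP[].
apply/le_anti/andP; split; last first.
  apply: comps_le => _ /imsetP[a /setIdP[/fP[_ afa _] aP] ->].
  exact: inside_le afa.
apply/part_leP=> x y xy; apply: (comps_cut edges_simple edges_indep).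
- exact: imsetS.
- by rewrite cE part_of_relE.
move=> _ /imsetP[a aA ->] NaS; apply/negPn/negP=> Nxy.
have NaP : a \notin S by apply: contra NaS => aS; apply: imset_f.
have [fa2 _ _] := fP aA; have faE : f a \in E by apply: imset_f.
have : ~~ inside (sub_join L (atoms L :\ a)) (f a).
  by apply: edge_not_inside; rewrite ?subsetDl ?setD11.
(* Here [Q] is the join of the atoms other than [a]. It lies above [P], which is the join of its own
   atoms and [a] is not among them; so it identifies [x] and [y], and [exchange] puts [f a] inside
   it. *)
apply/negP/negPn; apply: exchange (Nxy) (comps_edges_le aA) _ => //.
  by rewrite cE part_of_relE.
apply: (part_leP P _ _) xy; rewrite -(sub_join_atoms boolL PL).
apply: sub_join_le => [|b bS].
  by apply: sub_join_in; [case: boolL | rewrite subDset subsetU ?atoms_sub ?orbT].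
apply: le_sub_join; rewrite in_setD1 (subsetP SA) // andbT.
by apply: contraNneq NaP => <-.
Qed.

Lemma boolean_tree_lattice : dimension L = #|V|.-1 -> is_tree E /\ L = tree_lattice E.
Proof.
move=> dimL; have cE : comps E = \top%O.
  by apply/eqP; rewrite -indep_connected ?card_edges ?dimL //;
    [apply: edges_simple | apply: edges_indep].
split; first by apply/is_treeP => //; split; [apply: edges_simple | | apply: edges_indep].
apply/setP=> P; apply/idP/(tree_latticeP _ edges_simple)=> [PL|[F FE ->]].
  exists (f @: [set a in atoms L | (a <= P)%O]); last exact: boolean_comps.
  by apply: imsetS; apply/subsetP=> a; rewrite inE => /andP[].
(* The atoms whose edges form [F]. The atoms below their join are exactly [S], so [boolean_comps]
   identifies that join with [comps F]. *)
pose S := [set a in atoms L | f a \in F].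
have SA : S \subset atoms L by apply/subsetP=> a; rewrite inE => /andP[].
have SL : sub_join L S \in L.
  by apply: sub_join_in; [case: boolL | apply: subset_trans SA (atoms_sub L)].
have -> : F = f @: S.
  apply/setP=> e; apply/idP/imsetP=> [eF|[a /setIdP[_ aF] ->] //].
  have /imsetP[a aA def_e] := subsetP FE e eF.
  by exists a; rewrite // inE aA -def_e.
by move: (boolean_comps cE SL); rewrite (atoms_le_sub_join boolL SA) => <-.
Qed.

End Atoms.

Lemma boolean_dimension L : boolean_sublattice L -> dimension L <= #|V|.-1.
Proof.
move=> boolL; have [f fP] := atom_edges L; rewrite -(card_edges boolL fP).
by apply: indep_card => //; [exact: edges_simple fP | exact: (edges_indep boolL fP)].
Qed.

End TreeLattices.

Theorem proposition1p4 (V : finType) (n : nat) (hV : #|V| = n) (hn : 3 <= n) :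
  (forall L : {set part V},
     boolean_sublattice L ->
     (forall L' : {set part V}, boolean_sublattice L' -> #|L'| <= #|L|) ->
     dimension L = n.-1)
  /\
  ((forall E : {set {set V}}, is_tree E ->
      boolean_sublattice (tree_lattice E) /\ dimension (tree_lattice E) = n.-1)
   /\
   (forall L : {set part V}, boolean_sublattice L -> dimension L = n.-1 ->
      exists! E : {set {set V}}, is_tree E /\ L = tree_lattice E)).
Proof.
have V_gt0 : 0 < #|V| by rewrite hV; apply: leq_trans hn.
rewrite -{}hV.
(* Size alone fixes the dimension: it is at most [#|V|.-1], and [L] has at most [2 ^ dimension L]
   elements. The atoms of a tree lattice need not be computed. *)
have dim_large (L : {set part V}) : boolean_sublattice L -> 2 ^ #|V|.-1 <= #|L| ->
    dimension L = #|V|.-1.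
  move=> boolL leL; apply/eqP; rewrite eqn_leq boolean_dimension //=.
  by rewrite -(leq_exp2l (m := 2)) // (leq_trans leL) // card_boolean.
split=> [L boolL maxL|].
  (* A largest sublattice is at least as large as the lattice of some tree. *)
  have [E treeE] := exists_tree V_gt0; apply: dim_large => //.
  apply: leq_trans (card_tree_lattice V_gt0 treeE) (maxL _ _).
  exact: tree_boolean.
split=> [E treeE|L boolL dimL].
  have boolE := tree_boolean V_gt0 treeE; split=> //.
  exact: dim_large (card_tree_lattice V_gt0 treeE).
have [f fP] := atom_edges L.
have [treeE defL] := boolean_tree_lattice V_gt0 boolL fP dimL.
exists (f @: atoms L); split=> // E' [[sE' _ _] defL'].
have sE : simple_graph (f @: atoms L) by case: treeE.
have eqL : tree_lattice (f @: atoms L) = tree_lattice E' by rewrite -defL -defL'.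
apply/eqP; rewrite eqEsubset (tree_lattice_sub sE sE' eqL).
exact: tree_lattice_sub sE' sE (esym eqL).
Qed.
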